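(* Let $E\subseteq\mathbb C$ be a domain and let $H_K(E)$ be a reproducing kernel Hilbert space on $E$ whose kernel $K(q,\overline p)$ is holomorphic in $q$ and anti-holomorphic in $p$. Let $f\in H_K(E)$, and let $\{p_j\}_{j=1}^\infty$ be a sequence of points of $E$ (not necessarily distinct) all of whose elements are selected under the minimization principle: for every $n\ge 0$, with $p_1,\dots,p_n$ already selected, the point $p_{n+1}$ attains the minimum $$\|f-f^*_{A_{n+1}}\|=\min_{p\in E}\|f-f^*_{A_{n+1}(p)}\|,$$ where $A_{n+1}(p)$ is the matrix associated with the sequence $(p_1,\dots,p_n,p)$ and $A_{n+1}=A_{n+1}(p_{n+1})$. Then $$\lim_{n\to\infty}\|f-f^*_{A_n}\|=0 .$$
   Context: $H_K(E)$ is the reproducing kernel Hilbert space of complex functions on $E$ with kernel $K$: for each $p\in E$, $k_p:=K(\cdot,\overline p)\in H_K(E)$ and $\langle g,K(\cdot,\overline p)\rangle=g(p)$ for all $g\in H_K(E)$. The norm and inner product are those of $H_K(E)$. For a finite sequence $(p_1,\dots,p_n)$ of points of $E$, repetitions allowed, let $m_k$ be the cardinality of $\{j: p_j=p_k,\ j<k\}$ and put $$\widetilde K(\cdot,\overline{p}_k)=\frac{d^{m_k}}{d(\overline p)^{m_k}}\,k_p\Big|_{p=p_k}.$$ Thus $\langle g,\widetilde K(\cdot,\overline p_k)\rangle=g^{(m_k)}(p_k)$. The matrix associated with $(p_1,\dots,p_n)$ is $A_n=(a_{j,k})_{n\times n}$ with $$a_{j,k}=\langle \widetilde K(\cdot,\overline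 p_k),\widetilde K(\cdot,\overline p_j)\rangle .$$ Standing assumption: for every finite sequence of points of $E$ (repetitions allowed) the elements $\widetilde K(\cdot,\overline p_1),\dots,\widetilde K(\cdot,\overline p_n)$ are linearly independent, i.e. $A_n$ is positive definite. Define $$f^*_{A_n}=\sum_{j=1}^n\sum_{k=1}^n\langle f,\widetilde K(\cdot,\overline p_j)\rangle\,\widetilde{a^{(n)}_{j,k}}\,\widetilde K(\cdot,\overline p_k),$$ where $\widetilde{a^{(n)}_{j,k}}$ is the $(j,k)$ entry of $\overline{A_n^{-1}}$ (entrywise complex conjugate of the inverse of $A_n$). *)

(* Defs.v *)
From HB Require Import structures.
From mathcomp Require Import all_boot all_order all_algebra.
From mathcomp Require Import complex.
From mathcomp Require Import all_classical all_reals all_analysis.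

Set Implicit Arguments.
Unset Strict Implicit.
Unset Printing Implicit Defensive.

Import Order.TTheory GRing.Theory Num.Theory.
Import numFieldNormedType.Exports.

Local Open Scope classical_set_scope.
Local Open Scope ring_scope.

(* The topology of a field is declared in the library for field structures,
   not for the type constructor _[i]; packing R[i] as a structure makes it
   apply. *)
Definition Cplx (R : realType) : numClosedFieldType := R[i].

(* derivable f z 1 over the scalar field Cplx R is complex
   differentiability of f at z. *)
Definition holomorphic_on (R : realType) (E : set (Cplx R))
    (f : Cplx R -> Cplx R) : Prop :=
  forall z, E z -> derivable f z 1.

Definition antiholomorphic_on (R : realType) (E : set (Cplx R))
    (f : Cplx R -> Cplx R) : Prop :=
  holomorphic_on E (fun z => (f z)^*).

Definition domain (R : realType) (E : set (Cplx R)) : Prop :=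
  [/\ E !=set0, open E & connected E].

(* A Hilbert space of complex functions on E with reproducing kernel K; the
   kernel is a function of q and w = conj p, so that K(q, conj p) is literally
   K q p^*.  An element g is identified with the function ev g on E (by
   ev_linear and ev_inj); the values of ev g, K and kfun at points that do not
   come from E are irrelevant.  kfun w is the element K(., w), so k_p is
   kfun p^*.  The inner product is linear in its first argument. *)
Record rkhs (R : realType) (E : set (Cplx R)) (K : Cplx R -> Cplx R -> Cplx R) :=
  Rkhs {
  rkhs_sort :> completeNormedModType (Cplx R);
  inner : {dot rkhs_sort for @Num.conj (Cplx R)};
  rkhs_normE : forall g : rkhs_sort, `|g| ^+ 2 = inner g g;
  ev : rkhs_sort -> Cplx R -> Cplx R;
  ev_linear : forall (a : Cplx R) (g h : rkhs_sort) (q : Cplx R), E q ->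
    ev (a *: g + h) q = a * ev g q + ev h q;
  ev_inj : forall g h : rkhs_sort, (forall q, E q -> ev g q = ev h q) -> g = h;
  kfun : Cplx R -> rkhs_sort;
  kfunE : forall p q, E p -> E q -> ev (kfun p^*) q = K q p^*;
  reproducing : forall (g : rkhs_sort) p, E p -> inner g (kfun p^*) = ev g p
}.

Section Approximation.
Context (R : realType) (E : set (Cplx R)) (K : Cplx R -> Cplx R -> Cplx R).
Context (H : rkhs E K).

(* Points and matrix entries are indexed from 0. *)
Definition mult (s : seq (Cplx R)) (k : nat) : nat :=
  count_mem s`_k (take k s).

(* d/d(conj p) of the antiholomorphic map p |-> k_p = kfun (conj p) is the
   derivative of the H-valued map kfun in its own variable w = conj p. *)
Definition ktilde (s : seq (Cplx R)) (k : nat) : H :=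
  derive1n (mult s k) (@kfun R E K H) (s`_k)^*.

Definition gram (s : seq (Cplx R)) : 'M[Cplx R]_(size s) :=
  \matrix_(j, k) inner H (ktilde s k) (ktilde s j).

Definition fstar (f : H) (s : seq (Cplx R)) : H :=
  \sum_(j < size s) \sum_(k < size s)
    (inner H f (ktilde s j) * map_mx Num.conj (invmx (gram s)) j k)
      *: ktilde s k.

Definition ktilde_independent : Prop :=
  forall s : seq (Cplx R), (forall q, q \in s -> E q) ->
  forall c : 'I_(size s) -> Cplx R,
    \sum_(k < size s) c k *: ktilde s k = 0 -> forall k, c k = 0.

Definition min_selected (f : H) (p : nat -> Cplx R) : Prop :=
  forall n, E (p n) /\
    forall q, E q ->
      `|f - fstar f (rcons (mkseq p n) (p n))|
        <= `|f - fstar f (rcons (mkseq p n) q)|.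

End Approximation.

(* Main.v *)
(* The residual r_n = f - f*_{A_n} is orthogonal to the first n elements, so
   ||r_n - r_m||^2 = ||r_n||^2 - ||r_m||^2 for n <= m, and r_n converges to some
   g by completeness.  For q in E not among p_1, ..., p_n, comparing with the
   projection of r_n on the line through k_q gives, by minimality of p_{n+1},
   |r_n(q)|^2 <= (||r_n||^2 - ||r_{n+1}||^2) ||k_q||^2; for q among
   p_1, ..., p_n the left-hand side is 0.  Hence r_n(q) --> 0 for every q in E,
   so g = 0. *)
Require Import Defs.
From HB Require Import structures.
From mathcomp Require Import all_boot all_order all_algebra.
From mathcomp Require Import complex.
From mathcomp Require Import ring.
From mathcomp Require Import all_classical all_reals all_analysis.

Set Implicit Arguments.
Unset Strict Implicit.
Unset Printing Implicit Defensive.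

Import Order.TTheory GRing.Theory Num.Theory.
Import numFieldNormedType.Exports.

Local Open Scope classical_set_scope.
Local Open Scope ring_scope.

(** Nonnegative elements of [Cplx R] are real, so monotone convergence can be applied to the real
    parts; [u n - u m] is at most the distance from [u n] to the limit, uniformly in [m]. *)
Lemma nonincreasing_tail (R : realType) (u : nat -> Cplx R) :
  (forall n, 0 <= u n) -> (forall n, u n.+1 <= u n) ->
  forall e, 0 < e -> \forall n \near \oo, forall m, (n <= m)%N -> u n - u m < e.
Proof.
move=> u_ge0 u_dec e e_gt0.
pose v n := complex.Re (u n).
have uE n : u n = (v n)%:C%C :> R[i] by rewrite RRe_real //; exact: ger0_real.
have eE : e = (complex.Re e)%:C%C :> R[i] by rewrite RRe_real //; exact: gtr0_real.
have v_dec : {homo v : n m / (n <= m)%N >-> m <= n}.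
  by apply/nonincreasing_seqP => n; rewrite -(@lecR R) -!uE.
have v_cvg : cvgn v.
  apply: nonincreasing_is_cvgn => //; exists 0 => _ [n _ <-].
  by rewrite -(@lecR R) -uE u_ge0.
have re_gt0 : 0 < complex.Re e by rewrite -(@ltcR R) -eE.
move/cvgrPdist_lt: (v_cvg) => /(_ _ re_gt0); apply: filterS => n vn m nm.
rewrite uE uE eE -rmorphB /= ltcR.
have lim_le k : limn v <= v k by exact: nonincreasing_cvgn_ge.
apply: le_lt_trans vn; rewrite distrC ger0_norm ?subr_ge0 //.
by rewrite lerD2l lerN2.
Qed.

Lemma cvg0_sqr_norm_le (R : realType) (u v : nat -> Cplx R) (c : Cplx R) :
  0 <= c -> (forall n, 0 <= v n) -> (forall n, `|u n| ^+ 2 <= v n * c) ->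
  v n @[n --> \oo] --> 0 -> u n @[n --> \oo] --> 0.
Proof.
move=> c_ge0 v_ge0 uv /cvgr0Pnorm_lt v0; apply/cvgr0Pnorm_lt => e e_gt0.
(* The bound is divided by [c + 1] because [c] may be 0. *)
have c1_gt0 : 0 < c + 1 by rewrite ltr_wpDl.
apply: filterS (v0 _ (divr_gt0 (exprn_gt0 2 e_gt0) c1_gt0)) => n.
rewrite ger0_norm // ltr_pdivlMr // => vn.
rewrite -(@ltr_pXn2r _ 2) ?nnegrE ?(ltW e_gt0) //.
by apply: le_lt_trans (uv n) (le_lt_trans _ vn); rewrite ler_wpM2l // lerDl.
Qed.

Section dot.
Variables (C : numClosedFieldType) (U : lmodType C).
Variable form : {dot U for @Num.conj C}.

Lemma dotZl a u v : form (a *: u) v = a * form u v.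
Proof. exact: linearZl_LR. Qed.

Lemma dotZr a u v : form u (a *: v) = a^* * form u v.
Proof. exact: linearZr_LR. Qed.

Lemma dotC u v : form u v = (form v u)^*.
Proof. by rewrite (hermC form) expr0 mul1r. Qed.

Lemma dot_suml I (r : seq I) (F : I -> U) v :
  form (\sum_(i <- r) F i) v = \sum_(i <- r) form (F i) v.
Proof. exact: (big_morph (form^~ v) (linearDl form v) (linear0l form v)). Qed.

Lemma dot_sumr I (r : seq I) u (F : I -> U) :
  form u (\sum_(i <- r) F i) = \sum_(i <- r) form u (F i).
Proof. exact: (big_morph (form u) (linearDr form u) (linear0r form u)). Qed.

(* Also true for v = 0, where the quotients are 0. *)
Lemma dnorm_sub_proj u v :
  form (u - (form u v / form v v) *: v) (u - (form u v / form v v) *: v)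
  = form u u - `|form u v| ^+ 2 / form v v.
Proof.
have [->|v0] := eqVneq v 0; first by rewrite !linear0r mul0r scale0r invr0 mulr0 !subr0.
have vv : form v v != 0 by rewrite dnorm_eq0.
rewrite linearBl /= !linearBr /= !dotZl !dotZr (dotC v u).
rewrite rmorphM fmorphV /= (conj_Creal (ger0_real (dnorm_ge0 form v))) normCK.
by field.
Qed.

Lemma Cauchy_Schwarz_sqr u v : `|form u v| ^+ 2 <= form u u * form v v.
Proof.
have [->|v0] := eqVneq v 0; first by rewrite !linear0r normr0 expr0n.
rewrite -ler_pdivrMr ?dnorm_gt0 // -subr_ge0 -dnorm_sub_proj.
exact: dnorm_ge0.
Qed.

Lemma dnorm_addo u v : form u v = 0 -> form (u + v) (u + v) = form u u + form v v.
Proof.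
move=> uv; rewrite linearDl /= !linearDr /= (dotC v u) uv.
by rewrite conjC0 addr0 add0r.
Qed.

End dot.

Section projection.
Variables (R : realType) (E : set (Cplx R)) (K : Cplx R -> Cplx R -> Cplx R).
Variable H : rkhs E K.
Hypothesis ktilde_free : ktilde_independent H.

(** If [u *m gram H s = 0], the combination [h] of the [ktilde H s j] with coefficients conjugate to
    those of [u] is orthogonal to every [ktilde H s k], hence to itself. So [h = 0], and
    independence gives [u = 0]. *)
Lemma gram_unit s : (forall q, q \in s -> E q) -> gram H s \in unitmx.
Proof.
move=> sE; rewrite -row_free_unit -kermx_eq0; apply/eqP/row_matrixP => i.
rewrite row0; set u := row i _.
have uA : u *m gram H s = 0 by apply/sub_kermxP; exact: row_sub.
pose h : H := \sum_(j < size s) (u 0 j)^* *: ktilde H s j.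
have h0 : h = 0.
  apply/eqP; rewrite -(dnorm_eq0 (inner H)) {1}/h dot_suml /=; apply/eqP.
  apply: big1 => k _; rewrite dotZl.
  suff -> : inner H (ktilde H s k) h = 0 by rewrite mulr0.
  move/rowP: uA => /(_ k); rewrite mxE [RHS]mxE => uAk.
  rewrite /h dot_sumr -[RHS]uAk.
  by apply: eq_bigr => j _; rewrite dotZr conjCK [gram _ _ _ _]mxE.
apply/rowP => j; rewrite [RHS]mxE; apply/eqP; rewrite -conjC_eq0; apply/eqP.
exact: (ktilde_free sE h0 j).
Qed.

(** The sum over [k] collapses to the conjugate of an entry of [invmx (gram H s) *m gram H s], the
    identity. Thus [fstar f s] is the orthogonal projection of [f] on the span of the
    [ktilde H s i]. *)
Lemma inner_fstar f s i : (forall q, q \in s -> E q) -> (i < size s)%N ->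
  inner H (fstar f s) (ktilde H s i) = inner H f (ktilde H s i).
Proof.
move=> /gram_unit Au i_s; pose i' := Ordinal i_s.
rewrite /fstar dot_suml /=.
transitivity (\sum_(j < size s) inner H f (ktilde H s j) *
   ((invmx (gram H s) *m gram H s) j i')^*).
  apply: eq_bigr => j _; rewrite dot_suml /= mxE rmorph_sum mulr_sumr.
  apply: eq_bigr => k _; rewrite dotZl !mxE rmorphM mulrA; congr (_ * _).
  by rewrite dotC.
rewrite mulVmx // (bigD1 i') //= mxE eqxx rmorph1 mulr1 big1 ?addr0 // => j ji.
by rewrite mxE (negPf ji) rmorph0 mulr0.
Qed.

Lemma inner_resid_ktilde f s i : (forall q, q \in s -> E q) -> (i < size s)%N ->
  inner H (f - fstar f s) (ktilde H s i) = 0.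
Proof. by move=> sE i_s; rewrite linearBl /= inner_fstar // subrr. Qed.

Lemma inner_fstar_eq0 (f u : H) s :
  (forall i, (i < size s)%N -> inner H u (ktilde H s i) = 0) ->
  inner H u (fstar f s) = 0.
Proof.
move=> u0; rewrite dot_sumr big1 // => j _; rewrite dot_sumr big1 // => k _.
by rewrite dotZr u0 ?mulr0.
Qed.

(** The multiplicity counts earlier points only, so the spans are nested when a sequence is
    extended. *)
Lemma ktilde_cat s t i : (i < size s)%N -> ktilde H (s ++ t) i = ktilde H s i.
Proof.
by move=> i_s; rewrite /ktilde /mult nth_cat i_s takel_cat // ltnW.
Qed.

Lemma ktilde_rcons_new s q : q \notin s -> ktilde H (rcons s q) (size s) = kfun H q^*.
Proof.
move=> qs; rewrite /ktilde /mult nth_rcons ltnn eqxx -cats1 take_size_cat //.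
by rewrite (count_memPn qs).
Qed.

(** The first occurrence of [q] has multiplicity 0, so no derivative is taken there; hence residuals
    vanish at points already selected. *)
Lemma ktilde_index s q : q \in s -> ktilde H s (index q s) = kfun H q^*.
Proof.
move=> qs; rewrite /ktilde /mult nth_index //.
suff /count_memPn -> : q \notin take (index q s) s by [].
by rewrite in_take // ltnn.
Qed.

(** Pythagoras: both projections lie in the larger span, to which [f - fstar f (s ++ t)] is
    orthogonal. *)
Lemma dnorm_resid_cat f s t : (forall q, q \in s ++ t -> E q) ->
  inner H (fstar f (s ++ t) - fstar f s) (fstar f (s ++ t) - fstar f s) =
  inner H (f - fstar f s) (f - fstar f s) -
    inner H (f - fstar f (s ++ t)) (f - fstar f (s ++ t)).
Proof.
move=> stE; set a := fstar f (s ++ t); set b := fstar f s.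
have ab : inner H (f - a) (a - b) = 0.
  rewrite linearBr /= !inner_fstar_eq0 ?subrr // => i i_s.
    by rewrite -(ktilde_cat t) // inner_resid_ktilde // size_cat ltn_addr.
  exact: inner_resid_ktilde.
have := dnorm_addo ab; rewrite addrA subrK => ->.
by rewrite addrAC subrr add0r.
Qed.

(** The right-hand side is the squared norm of [r - c *: k], which is [f] minus an element of the
    span for [rcons s q]; the projection on that span is a best approximation. *)
Lemma dnorm_resid_rcons_le f s q : (forall z, z \in rcons s q -> E z) -> q \notin s ->
  inner H (f - fstar f (rcons s q)) (f - fstar f (rcons s q)) <=
  inner H (f - fstar f s) (f - fstar f s) -
    `|inner H (f - fstar f s) (kfun H q^*)| ^+ 2
      / inner H (kfun H q^*) (kfun H q^*).
Proof.
move=> sE qs; rewrite -dnorm_sub_proj.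
set k := kfun _ _; set r := f - fstar f s; set a := f - fstar _ _; set c := _ / _.
have ak : inner H a (r - c *: k - a) = 0.
  have a_orth i : (i < size (rcons s q))%N -> inner H a (ktilde H (rcons s q) i) = 0.
    exact: inner_resid_ktilde.
  have -> : r - c *: k - a = fstar f (rcons s q) - fstar f s - c *: k.
    rewrite /r /a opprB addrAC; congr (_ - _).
    by rewrite addrC [LHS]addrA subrK.
  rewrite linearBr /= linearBr /= dotZr inner_fstar_eq0 // inner_fstar_eq0; last first.
    by move=> i i_s; rewrite -(ktilde_cat [:: q]) // cats1 a_orth // size_rcons ltnW.
  by rewrite /k -(ktilde_rcons_new qs) a_orth ?size_rcons // mulr0 !subr0.
have := dnorm_addo ak; rewrite addrC subrK => ->.
by rewrite lerDl dnorm_ge0.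
Qed.

End projection.

Theorem theorem2p2 (R : realType) (E : set (Cplx R))
    (K : Cplx R -> Cplx R -> Cplx R) (H : rkhs E K)
    (Edom : domain E)
    (Khol : forall p, E p -> holomorphic_on E (fun q => K q p^*))
    (Kantihol : forall q, E q -> antiholomorphic_on E (fun p => K q p^*))
    (Hindep : ktilde_independent H)
    (f : H) (p : nat -> Cplx R)
    (Hp : min_selected f p) :
  `|f - fstar f (mkseq p n)| @[n --> \oo] --> (0 : Cplx R).

Proof.
have mem_E n q : q \in mkseq p n -> E q by case/mapP => i _ ->; exact: (Hp i).1.
pose r n := f - fstar f (mkseq p n).
pose d n := inner H (r n) (r n).
have dE n : d n = `|r n| ^+ 2 by rewrite rkhs_normE.
have norm_rB n m : (n <= m)%N -> `|r n - r m| ^+ 2 = d n - d m.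
  move=> nm; pose t := [seq p i | i <- iota n (m - n)].
  have mE : mkseq p m = mkseq p n ++ t by rewrite /mkseq -map_cat -iotaD subnKC.
  rewrite rkhs_normE /d /r mE -dnorm_resid_cat -?mE //; last exact: mem_E.
  by rewrite opprB addrC addrA subrK.
have d_dec n m : (n <= m)%N -> d m <= d n.
  by move=> nm; rewrite -subr_ge0 -norm_rB // exprn_ge0.
have d_tail e : 0 < e ->
    \forall n \near \oo, forall m, (n <= m)%N -> d n - d m < e.
  by move: e; apply: nonincreasing_tail => n; [exact: dnorm_ge0 | exact: d_dec].
have r_cvg : cvgn r.
  apply/cauchy_cvgP/cauchy_exP => e e_gt0.
  (* The tail bound is taken at [e ^+ 2] since [norm_rB] controls squared distances. *)
  have [N _ dN] := d_tail _ (exprn_gt0 2 e_gt0).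
  exists (r N); exists N => // m /= Nm; rewrite -ball_normE /=.
  have := dN N (leqnn N) m Nm.
  by rewrite -norm_rB // ltr_pXn2r ?nnegrE ?(ltW e_gt0).
pose g := limn r.
have g_lim : r n @[n --> \oo] --> g by [].
have g0 : g = 0.
  apply: ev_inj => q Eq; rewrite -!reproducing // linear0l.
  set k := kfun H q^*.
  have d_diff_ge0 n : 0 <= d n - d n.+1 by rewrite subr_ge0 d_dec.
  have bound n : `|inner H (r n) k| ^+ 2 <= (d n - d n.+1) * inner H k k.
    have [qn|qn] := boolP (q \in mkseq p n).
      rewrite /k -(ktilde_index H qn) inner_resid_ktilde ?index_mem //; last exact: mem_E.
      by rewrite normr0 expr0n mulr_ge0 // dnorm_ge0.
    have [->|k0] := eqVneq k 0; first by rewrite !linear0r normr0 expr0n.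
    rewrite -ler_pdivrMr ?dnorm_gt0 // lerBrDl -lerBrDr.
    have nE z : z \in rcons (mkseq p n) q -> E z.
      by rewrite mem_rcons inE => /orP[/eqP->//|]; exact: mem_E.
    apply: (le_trans _ (dnorm_resid_rcons_le Hindep f nE qn)).
    (* [mkseq p n.+1] is [rcons (mkseq p n) (p n)], so what remains is the minimality of [p n]
       against the competitor [q]. *)
    rewrite -rkhs_normE dE /r mkseqS ler_pXn2r ?nnegrE //.
    exact: (Hp n).2.
  have lim0 : inner H (r n) k @[n --> \oo] --> 0.
    apply: (cvg0_sqr_norm_le _ d_diff_ge0 bound) => //.
    apply/cvgr0Pnorm_lt => e /d_tail; apply: filterS => n /(_ _ (leqnSn n)).
    by rewrite ger0_norm.
  (* Continuity of the inner product in its first argument, from Cauchy-Schwarz. *)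
  have limg : inner H (r n - g) k @[n --> \oo] --> 0.
    apply: (@cvg0_sqr_norm_le _ _ (fun n => `|r n - g| ^+ 2) _
              (dnorm_ge0 (inner H) k)) => [n|n|]; first exact: exprn_ge0.
      by rewrite rkhs_normE Cauchy_Schwarz_sqr.
    have rg : `|r n - g| @[n --> \oo] --> 0.
      rewrite -(normr0 H) -(subrr g); apply: cvg_norm.
      by apply: cvgB => //; exact: cvg_cst.
    by rewrite -(mulr0 0); exact: (cvgM rg rg).
  (* This sequence is constantly [inner H g k], so uniqueness of limits makes that value 0. *)
  have : inner H (r n) k - inner H (r n - g) k @[n --> \oo] --> 0 - 0.
    exact: (cvgB lim0 limg).
  under eq_fun do rewrite -linearBl /= subKr.
  rewrite subrr => lim.
  by apply: cvg_unique (cvg_cst _) lim; exact: norm_hausdorff.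
by rewrite -(normr0 H) -g0; exact: cvg_norm g_lim.
Qed.
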